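(* Let $n>2$ be an even natural number. For every even number $c$ with $n-1\le c\le (n-1)(n-2)$, there exists an Abhyankar-Moh semigroup of degree $n$ whose conductor is equal to $c$.
   Context: A numerical semigroup is an additive submonoid $S$ of $\mathbb{N}=\{0,1,2,\dots\}$ with finite complement in $\mathbb{N}$. Its Frobenius number is the largest integer not in $S$ (so it is $-1$ for $S=\mathbb{N}$), and its conductor is the Frobenius number plus $1$. A sequence of positive integers $(v_0,\ldots,v_h)$ is a characteristic sequence if, putting $e_k=\gcd(v_0,\ldots,v_k)$ for $0\le k\le h$, one has (CS1) $e_k<e_{k-1}$ for $1\le k\le h$ and $e_h=1$; and (CS2) $e_{k-1}v_k<e_kv_{k+1}$ for $1\le k\le h-1$. Denote by $S(v_0,\ldots,v_h)=\mathbb{N}v_0+\cdots+\mathbb{N}v_h$ the numerical semigroup generated by the characteristic sequence. A semigroup is an Abhyankar-Moh semigroup of degree $n>1$ if it equals $S(v_0,\ldots,v_h)$ for some characteristic sequence $(v_0,\ldots,v_h)$ with $v_0=n$ satisfying the Abhyankar-Moh inequality $e_{h-1}v_h<n^2$. *)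

(* Defs.v *)
From mathcomp Require Import all_boot all_order all_algebra.
From mathcomp Require Import classical_sets cardinality.

Set Implicit Arguments.
Unset Strict Implicit.
Unset Printing Implicit Defensive.

Local Open Scope classical_set_scope.

Definition numerical_semigroup (S : set nat) : Prop :=
  [/\ S 0, forall x y, S x -> S y -> S (x + y) & finite_set (~` S)].

(* [S] is viewed inside the integers, so that negative integers lie outside
   [S] and the Frobenius number of [setT] is -1. *)
Definition is_frobenius (S : set nat) (f : int) : Prop :=
  let SZ : set int := Posz @` S in
  ~ SZ f /\ forall z : int, ~ SZ z -> (z <= f)%R.

Definition is_conductor (S : set nat) (c : nat) : Prop :=
  exists2 f : int, is_frobenius S f & (c%:Z = f + 1)%R.

Definition char_gcd (v : seq nat) (k : nat) : nat :=
  \big[gcdn/0]_(0 <= i < k.+1) nth 0 v i.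

Definition char_sequence (h : nat) (v : h.+1.-tuple nat) : Prop :=
  let e := char_gcd v in
  [/\ forall k, k <= h -> 0 < nth 0 v k,
      forall k, 1 <= k <= h -> e k < e k.-1,
      e h = 1
    & forall k, 1 <= k < h -> e k.-1 * nth 0 v k < e k * nth 0 v k.+1].

Definition generated_semigroup (h : nat) (v : h.+1.-tuple nat) : set nat :=
  [set s | exists a : 'I_h.+1 -> nat, s = \sum_(i < h.+1) a i * nth 0 v i].

(* [1 < n] together with [char_sequence v] forces [0 < h], so the predecessor
   [h.-1] below is never truncated. *)
Definition abhyankar_moh (n : nat) (S : set nat) : Prop :=
  [/\ 1 < n,
      numerical_semigroup S
    & exists h (v : h.+1.-tuple nat),
        [/\ char_sequence v, nth 0 v 0 = n, S = generated_semigroup v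
          & char_gcd v h.-1 * nth 0 v h < n ^ 2]].

(* Main.v *)
Require Import Defs.
From mathcomp Require Import all_boot all_order all_algebra.
From mathcomp Require Import classical_sets cardinality.
From mathcomp Require Import zify.

Set Implicit Arguments.
Unset Strict Implicit.
Unset Printing Implicit Defensive.

(** The proof rests on gluing. If [T] is a numerical semigroup of conductor [c],
    [w] lies in [T] and [gcd(d, w) = 1], then [d T + N w] has conductor
    [d c + (d - 1) (w - 1)] (lemma [glue_conductor]). If [T] is generated by a
    characteristic sequence [(v_0, ..., v_h)], then [d T + N w] is generated by
    [(d v_0, ..., d v_h, w)], which is again characteristic as soon as
    [d e_{h-1} v_h < w]. Starting from [T = N] this gives the semigroups
    [<m, a>]; then gluing with [d = 2] doubles degrees.

    Write [B = e_{h-1} v_h] for the quantity in the Abhyankar-Moh inequality.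
    From a semigroup of degree [m] with data [(c, B)] and an odd [w > 2 B],
    doubling yields degree [2 m], conductor [2 c + w - 1] and new [B] equal to
    [2 w]. The inequality [2 w < (2 m)^2] allows [w] up to [2 m^2 - 1], so every
    conductor [2 s] with [c + B <= s < c + m^2] is obtained
    ([realizes_double]). For [n = 2 m] the theorem thus becomes a covering
    statement, [covers m]: these intervals cover all [s] from [m] to
    [(m - 1) (2 m - 1)].

    If [m] is odd, the semigroups [<m, a>] with [a = m - 2^j] or [a = 1] suffice:
    [a] is prime to [m], and halving [m - a] is a small enough step for
    consecutive intervals to overlap ([covers_odd]). If [m = 2 p], the
    difficulty is that few [a] may be prime to [m]; instead one argues by
    induction on [m]. [covers p] already provides degree [m] semigroups whose
    conductors are all the even numbers from [m] to [(m - 1) (m - 2)], each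
    with [B <= m^2 - 2]; two consecutive ones have overlapping intervals, and
    [(m, 1)] and [(m, 2, m + 1)] handle the small [s] ([covers_double]). *)

(** * Conductors and gluing *)

(** Conductors inside [nat]: quantifying over [x.+1 = c] in the second clause
    makes it vacuous at [c = 0], where the Frobenius number is -1. *)
Definition conductor_spec (T : nat -> Prop) (c : nat) : Prop :=
  (forall x, c <= x -> T x) /\ (forall x, x.+1 = c -> ~ T x).

Lemma coprime_residue d w x : 0 < d -> coprime d w ->
  exists2 k, k < d & k * w = x %[mod d].
Proof.
move=> d0 co; have [w0|w0] := posnP w.
  move: co; rewrite w0 /coprime gcdn0 => /eqP ->.
  by exists 0 => //; rewrite !modn1.
case: (egcdnP d w0) => u v eq_uv _; rewrite gcdnC (eqP co) in eq_uv.
exists ((u * x) %% d); first by rewrite ltn_mod.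
by rewrite modnMml mulnAC eq_uv mulnDl mul1n mulnAC modnMDl.
Qed.

(** Modulo [d] every [x] is congruent to some [k w] with [k < d], and [x] is in
    the glued semigroup once [(x - k w) / d] is in [T]; the worst case is
    [k = d - 1]. Conversely, an expression [d t + k w] of
    [d (c - 1) + (d - 1) w] forces [k = q d - 1] with [q >= 1], so
    [c - 1 = t + (q - 1) w], which would lie in [T] because [w] does. *)
Lemma glue_conductor (T : nat -> Prop) c d w :
  (forall x y, T x -> T y -> T (x + y)) -> conductor_spec T c ->
  0 < d -> 0 < w -> coprime d w -> T w ->
  conductor_spec (fun x => exists t k, T t /\ x = d * t + k * w)
    (d * c + (d - 1) * (w - 1)).
Proof.
move=> TD [Tge Tlt] d0 w0 co Tw; split=> [x hx|x hx [t [k [Tt Dx]]]].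
  have [k kd kx] := coprime_residue x d0 co.
  have kwx : k * w < x + d by nia.
  have le_kw : k * w <= x.
    case: (leqP (k * w) x) => // lt_x.
    move/eqP: kx; rewrite eqn_mod_dvd ?(ltnW lt_x)// => /dvdn_leq; lia.
  move/esym/eqP: kx; rewrite eqn_mod_dvd // => /dvdnP [t Dt].
  exists t, k; split; last by lia.
  apply: Tge; nia.
have sumE : d * t + d + k.+1 * w = d * (c + w) by nia.
have /dvdnP [q Dq] : d %| k.+1.
  rewrite -(Gauss_dvdl _ co) -(@dvdn_addr (d * t + d)) ?sumE ?dvdn_mulr //.
  by rewrite dvdn_add ?dvdn_mulr.
have q0 : 0 < q by case: q Dq.
have Tlw l : T (t + l * w).
  by elim: l => [|l IH]; rewrite ?mul0n ?addn0// mulSn addnCA addnC; apply: TD.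
apply: (Tlt _ _ (Tlw (q - 1))).
have /eqP : d * (t + q * w).+1 = d * (c + w).
  by rewrite -sumE Dq mulnS mulnDr (mulnC q d) mulnA; lia.
by rewrite eqn_pmul2l // => /eqP; case: q q0 {Dq} => // q _; lia.
Qed.

Lemma generatedP h (v : h.+1.-tuple nat) s :
  generated_semigroup v s <->
  exists a : nat -> nat, s = \sum_(i < h.+1) a i * nth 0 v i.
Proof.
split=> [[a ->]|[a ->]]; last by exists (fun i => a i).
by exists (fun i => a (inord i)); apply: eq_bigr => i _; rewrite inord_val.
Qed.

Lemma generatedD h (v : h.+1.-tuple nat) x y :
  generated_semigroup v x -> generated_semigroup v y ->
  generated_semigroup v (x + y).
Proof.
move=> [a ->] [b ->]; exists (fun i => a i + b i).
by rewrite -big_split; apply: eq_bigr => i _; rewrite mulnDl.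
Qed.

Lemma generated_numerical h (v : h.+1.-tuple nat) c :
  conductor_spec (generated_semigroup v) c ->
  numerical_semigroup (generated_semigroup v).
Proof.
move=> [vge _]; split; last 1 first.
- apply: (sub_finite_set _ (finite_II c)) => x /= nx.
  by rewrite ltnNge; apply/negP => /vge.
- by exists (fun=> 0); rewrite big1.
- exact: generatedD.
Qed.

Lemma conductor_specP (S : set nat) c : conductor_spec S c -> is_conductor S c.
Proof.
move=> [Sge Slt]; exists (Posz c - 1)%R; last by lia.
split=> [[x Sx Dx]|z Sz].
  by apply: (Slt x) => //; lia.
case: z Sz => [x|x] Sz; last by lia.
suff : x < c by lia.
by rewrite ltnNge; apply/negP => /Sge Sx; apply: Sz; exists x.
Qed.

(** * Gluing characteristic sequences *)

Definition glue_seq h (d w : nat) (v : h.+1.-tuple nat) : h.+2.-tuple nat :=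
  [tuple of rcons (map (muln d) v) w].

Section GlueSeq.
Variables (h d w : nat) (v : h.+1.-tuple nat).

Lemma nth_glue_seq k : k <= h -> nth 0 (glue_seq d w v) k = d * nth 0 v k.
Proof.
move=> kh; rewrite nth_rcons size_map size_tuple ltnS kh.
by rewrite (nth_map 0) // size_tuple.
Qed.

Lemma nth_glue_seq_last : nth 0 (glue_seq d w v) h.+1 = w.
Proof. by rewrite nth_rcons size_map size_tuple ltnn eqxx. Qed.

Lemma char_gcd_glue_seq k :
  k <= h -> char_gcd (glue_seq d w v) k = d * char_gcd v k.
Proof.
elim: k => [|k IH] kh; rewrite /char_gcd.
  by rewrite !big_nat1 nth_glue_seq.
rewrite !(big_nat_recr k.+1) //= nth_glue_seq // muln_gcdr.
by congr gcdn; apply: IH; apply: ltnW.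
Qed.

Lemma char_gcd_glue_seq_last :
  char_gcd v h = 1 -> char_gcd (glue_seq d w v) h.+1 = gcdn d w.
Proof.
move=> eh; rewrite /char_gcd (big_nat_recr h.+1) //= nth_glue_seq_last.
by rewrite -/(char_gcd _ h) char_gcd_glue_seq // eh muln1.
Qed.

Lemma generated_glue_seq x :
  generated_semigroup (glue_seq d w v) x <->
  exists t k, generated_semigroup v t /\ x = d * t + k * w.
Proof.
have sumE (a : nat -> nat) :
    \sum_(i < h.+2) a i * nth 0 (glue_seq d w v) i
    = d * (\sum_(i < h.+1) a i * nth 0 v i) + a h.+1 * w.
  rewrite big_ord_recr nth_glue_seq_last big_distrr.
  congr addn; apply: eq_bigr => i _.
  have ih : i <= h by rewrite -ltnS ltn_ord.
  by rewrite /= nth_glue_seq // mulnCA.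
split=> [/generatedP [a ->]|[t [k [/generatedP [a ->] ->]]]].
  exists (\sum_(i < h.+1) a i * nth 0 v i), (a h.+1); split; last exact: sumE.
  by apply/generatedP; exists a.
pose b i := if i <= h then a i else k.
apply/generatedP; exists b; rewrite sumE {2}/b ltnn.
congr (d * _ + _); apply: eq_bigr => i _.
by rewrite /b -ltnS ltn_ord.
Qed.

(** The first [h + 1] terms are scaled by [d], so only the last step of each
    condition is new. For [h = 0] that step is not constrained by (CS2), hence
    the guard [0 < h], which lets [(1)] be extended to [(d, w)] with [w < d]. *)
Lemma char_sequence_glue_seq :
  char_sequence v -> 1 < d -> 0 < w -> coprime d w ->
  (0 < h -> d * (char_gcd v h.-1 * nth 0 v h) < w) ->
  char_sequence (glue_seq d w v).
Proof.
move=> [vpos vdec vh vinc] d1 w0 co ltw.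
have eh := char_gcd_glue_seq_last vh; split.
- move=> k; rewrite leq_eqVlt => /predU1P [->|kh].
    by rewrite nth_glue_seq_last.
  by rewrite nth_glue_seq // muln_gt0 vpos // (ltnW d1).
- case=> // k /andP [_]; rewrite ltnS leq_eqVlt => /predU1P [->|kh].
    by rewrite eh char_gcd_glue_seq // vh muln1 (eqP co).
  rewrite !char_gcd_glue_seq ?(ltnW kh) // ltn_pmul2l ?(ltnW d1) //.
  exact: (vdec k.+1).
- by rewrite eh; apply/eqP.
- move=> k /andP [k0]; rewrite ltnS leq_eqVlt => /predU1P [Dk|kh].
    rewrite Dk in k0 *.
    rewrite nth_glue_seq_last !char_gcd_glue_seq ?leq_pred // nth_glue_seq //.
    by rewrite vh muln1 -mulnA ltn_pmul2l ?(ltnW d1) // mulnCA ltw.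
  have kh' := ltnW kh; have kp := leq_trans (leq_pred k) kh'.
  rewrite !char_gcd_glue_seq // !nth_glue_seq // -!mulnA.
  rewrite ltn_pmul2l ?(ltnW d1) // !(mulnCA _ d).
  by rewrite ltn_pmul2l ?(ltnW d1) // vinc // k0.
Qed.

End GlueSeq.

(** * Degrees, conductors and the Abhyankar-Moh quantity *)

(** Degree [n], conductor [c] and [B = e_{h-1} v_h]. The bound [c <= B] is kept
    along so that a new generator [w > B] automatically lies in the
    semigroup, as gluing requires. *)
Definition realizes (n c B : nat) : Prop :=
  exists h (v : h.+1.-tuple nat),
    [/\ char_sequence v /\ nth 0 v 0 = n,
        conductor_spec (generated_semigroup v) c,
        0 < h,
        char_gcd v h.-1 * nth 0 v h = B
      & c <= B].

Lemma glue_realizes h (v : h.+1.-tuple nat) c d w :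
  char_sequence v -> conductor_spec (generated_semigroup v) c ->
  1 < d -> 0 < w -> coprime d w -> c <= w ->
  (0 < h -> d * (char_gcd v h.-1 * nth 0 v h) < w) ->
  d * c < w + d ->
  realizes (d * nth 0 v 0) (d * c + (d - 1) * (w - 1)) (d * w).
Proof.
move=> cs vc d1 w0 co cw ltw dc; exists h.+1, (glue_seq d w v).
have [_ _ vh _] := cs; split => //.
- by split; [exact: char_sequence_glue_seq | exact: nth_glue_seq].
- have [] := glue_conductor (@generatedD _ v) vc (ltnW d1) w0 co (vc.1 _ cw).
  move=> ge lt; split=> [x /ge|x /lt nx]; first by move/generated_glue_seq.
  by move/generated_glue_seq.
- by rewrite nth_glue_seq_last char_gcd_glue_seq // vh muln1.
- nia.
Qed.

(** The semigroup [<m, a>] is the gluing of [N] with [d = m] and [w = a]. *)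
Lemma realizes_two m a : 1 < m -> 0 < a -> coprime m a ->
  realizes m ((m - 1) * (a - 1)) (m * a).
Proof.
move=> m1 a0 co; pose v := [tuple 1].
have vE x : generated_semigroup v x.
  by exists (fun=> x); rewrite big_ord1 muln1.
have cs : char_sequence v.
  by split; try (by case=> [|[]]); rewrite /char_gcd big_nat1.
have vc : conductor_spec (generated_semigroup v) 0 by split.
have := glue_realizes cs vc m1 a0 co.
by rewrite /= muln0 !muln1 add0n; apply=> //; lia.
Qed.

(** Gluing with [d = 2] and [w = 2 (s - c) + 1], the only [w] giving conductor
    [2 s]; the hypothesis on [s] amounts to [2 B < w]. *)
Lemma realizes_double m c B s : realizes m c B -> c + B <= s ->
  realizes (2 * m) (2 * s) (2 * (2 * (s - c) + 1)).
Proof.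
move=> [h [v [[cs <-] vc h0 DB cB]]] le_s.
have -> : 2 * s = 2 * c + (2 - 1) * ((2 * (s - c) + 1) - 1) by lia.
apply: glue_realizes => //; rewrite ?DB; try lia.
by rewrite coprime2n oddD oddM.
Qed.

(** * Covering the range of conductors *)

(** The bound [s < c + m ^ 2] is the Abhyankar-Moh inequality for the sequence
    obtained by doubling, and [(m - 1) (2 m - 1)] is [(n - 1) (n - 2) / 2] for
    [n = 2 m]. *)
Definition covers m := forall s, m <= s <= (m - 1) * (2 * m - 1) ->
  exists c B, realizes m c B /\ c + B <= s < c + m ^ 2.

(** No integer is missed between the interval of [<m, a>] and that of [<m, b>]
    when the step from [a] up to [b] is at most half of [m - a]. *)
Lemma halving_overlap m a b s : 0 < a <= m -> 2 * b <= m + a ->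
  s < (m - 1) * (b - 1) + m * b -> s < (m - 1) * (a - 1) + m ^ 2.
Proof.
case: m => [|m]; first by lia.
case: a => // a; rewrite !subn1 /= => am le_b.
have : (2 * m + 1) * (2 * b) <= (2 * m + 1) * (m.+1 + a.+1).
  by rewrite leq_mul2l le_b orbT.
case: b le_b => [|b] le_b; nia.
Qed.

(** Take the least [j] for which the interval of [a = m - 2^j] starts at or
    before [s]. Minimality says that [s] is below the start of the interval of
    [m - 2^(j-1)], so by [halving_overlap] it is in the one of [a]. When
    [2^j >= m], the value [a = 1] replaces [m - 2^j]. *)
Lemma covers_odd m : odd m -> covers m.
Proof.
move=> om s /andP [ms sm]; have m1 : 1 < m by nia.
pose P j := (m - 1) * (m - 2 ^ j - 1) + m * (m - 2 ^ j) <= s.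
have exP : exists j, P j.
  (* Truncated subtraction makes the start of the interval 0 when [2 ^ j >= m]. *)
  exists m; rewrite /P; have := ltn_expl m (isT : 1 < 2).
  nia.
case: (ex_minnP exP) => j Pj jmin.
have [jm|mj] := ltnP (2 ^ j) m.
  exists ((m - 1) * (m - 2 ^ j - 1)), (m * (m - 2 ^ j)); split.
    apply: realizes_two => //; first by lia.
    have : coprime (2 ^ j) m by rewrite coprimeXl // coprime2n.
    rewrite -{1 2}(subnK (ltnW jm)) /coprime gcdnDr gcdnC.
    by rewrite [gcdn (_ + _) _]gcdnC gcdnDl.
  apply/andP; split; first exact: Pj.
  (* For [j = 0] it is the upper bound on [s] that is used: [a = m - 1] reaches
     [(m - 1) (2 m - 1)] exactly. *)
  case: j jm jmin {Pj} => [|j] jm jmin.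
    by rewrite expn0 {exP jmin P}; nia.
  have : ~~ P j by apply/negP => /jmin; rewrite ltnn.
  rewrite /P -ltnNge; apply: halving_overlap; rewrite expnS in jm *; lia.
exists ((m - 1) * (1 - 1)), (m * 1); split.
  by apply: realizes_two; rewrite ?coprimen1.
rewrite subnn muln0 muln1 ms /=.
case: j mj jmin {Pj} => [|j] mj jmin; first by rewrite expn0 in mj; lia.
have : ~~ P j by apply/negP => /jmin; rewrite ltnn.
rewrite /P -ltnNge => /(@halving_overlap _ 1); rewrite subnn muln0; apply.
  exact: ltnW.
rewrite expnS in mj; lia.
Qed.

(** Three ranges of [s], with [m = 2 p]. The sequence [(m, 1)] has conductor 0 and
    covers [s < m^2]. Next, [c = m] has to be realized with [B] well below
    [m^2]: [(m, 2, m + 1)] has [B = 2 m + 2], and covers [s < m^2 + m]. For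
    larger [s], any [2 k] in [s - m^2 + 1, s - m^2 + 2] is the conductor of
    some double of a degree [p] semigroup, and the bound [B <= m^2 - 2] gives
    [2 k + B <= s]. *)
Lemma covers_double p : 0 < p -> covers p -> covers (2 * p).
Proof.
move=> p0 IH s /andP [ms sm].
have one_step q : 1 < q -> realizes q 0 q.
  move=> q1; have := realizes_two q1 (ltn0Sn 0) (coprimen1 q).
  by rewrite subnn muln0 muln1.
have [s1|s1] := ltnP s ((2 * p) ^ 2).
  by exists 0, (2 * p); split; [apply: one_step; lia | lia].
have p1 : 1 < p by nia.
have [s2|s2] := ltnP s ((2 * p) ^ 2 + 2 * p).
  exists (2 * p), (2 * (2 * (p - 0) + 1)); split; last by nia.
  exact: realizes_double (one_step _ p1) _.
pose k := (s - (2 * p) ^ 2 + 2) %/ 2.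
have hk : s - (2 * p) ^ 2 + 1 <= 2 * k <= s - (2 * p) ^ 2 + 2 by rewrite /k; lia.
have [|c [B [rB /andP [le_k lt_k]]]] := IH k; first by nia.
exists (2 * k), (2 * (2 * (k - c) + 1)); split; last by nia.
exact: realizes_double rB le_k.
Qed.

Lemma coversP m : 0 < m -> covers m.
Proof.
elim/ltn_ind: m => m IH m0; have [om|em] := boolP (odd m).
  exact: covers_odd.
have -> : m = 2 * m./2 by lia.
by apply: covers_double; [lia | apply: IH; lia].
Qed.

Theorem theorem1 (n : nat) (hn : 2 < n) (neven : ~~ odd n)
    (c : nat) (ceven : ~~ odd c) (hc : n - 1 <= c <= (n - 1) * (n - 2)) :
  exists S : set nat, abhyankar_moh n S /\ is_conductor S c.
Proof.
pose m := n./2; pose s := c./2.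
have Dn : n = 2 * m by lia.
have Dc : c = 2 * s by lia.
have m1 : 1 < m by lia.
have s_range : m <= s <= (m - 1) * (2 * m - 1) by nia.
have [c' [B [rB /andP [le_s lt_s]]]] := coversP (ltnW m1) s_range.
have [h [v [[cs v0] vc h0 DB _]]] := realizes_double rB le_s.
exists (generated_semigroup v); split; last by rewrite Dc; exact: conductor_specP.
split; [lia | exact: generated_numerical vc |].
exists h, v; split=> //; first by rewrite Dn.
by rewrite DB Dn; nia.
Qed.
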